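(* Let $\mathcal{R}=\langle R; +, <, \dots\rangle$ be a definably complete expansion of a divisible ordered Abelian group of burden $2$, and let $D \subseteq R$ be definable and discrete. Then $D$ is a finite union of points and pseudo-arithmetic sets.
   Context: ''Definable'' means with parameters; ''discrete'' refers to the order topology. Definably complete: every nonempty definable subset of $R$ bounded above has a least upper bound. Burden: supremum of depths of inp-patterns in one variable. For a discrete set $E$ and a non-maximal $a\in E$, $S_E(a)=\min\{b\in E: b>a\}$, and $E'=\{S_E(a)-a : a\in E \text{ not maximal}\}$. A discrete set $E$ is pseudo-arithmetic if $|E'|=1$. *)

(* Defs.v *)
From HB Require Import structures.
From mathcomp Require Import all_boot all_order all_algebra.
From mathcomp Require Import all_classical.
From mathcomp Require Import topology_structure order_topology.
Set Implicit Arguments.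
Unset Strict Implicit.
Unset Printing Implicit Defensive.
Import Order.TTheory GRing.Theory Num.Theory.
Local Open Scope classical_set_scope.
Local Open Scope card_scope.
Local Open Scope ring_scope.

(** * First-order logic *)

Record language := Language {
  fsym : Type; farity : fsym -> nat;
  rsym : Type; rarity : rsym -> nat }.

Inductive term (L : language) : Type :=
| Var of nat
| App (f : fsym L) of 'I_(farity f) -> term L.

(* Variables are de Bruijn indices: [All phi] binds index 0 of [phi].
   The semantics is classical, so these connectives suffice. *)
Inductive formula (L : language) : Type :=
| Eq of term L & term L
| Rel (r : rsym L) of 'I_(rarity r) -> term L
| Bot
| Imp of formula L & formula L
| All of formula L.

Arguments Var {L}.
Arguments Bot {L}.

Record interpretation (L : language) (M : Type) := Interpretation {
  fint : forall f : fsym L, ('I_(farity f) -> M) -> M;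
  rint : forall r : rsym L, ('I_(rarity r) -> M) -> Prop }.

Definition scons (M : Type) (x : M) (e : nat -> M) (n : nat) : M :=
  if n is n'.+1 then e n' else x.

Fixpoint eval L M (I : interpretation L M) (e : nat -> M) (t : term L) : M :=
  match t with
  | Var n => e n
  | App f ts => fint I (fun i => eval I e (ts i))
  end.

Fixpoint sat L M (I : interpretation L M) (e : nat -> M) (phi : formula L) :
    Prop :=
  match phi with
  | Eq s t => eval I e s = eval I e t
  | Rel r ts => rint I (fun i => eval I e (ts i))
  | Bot => False
  | Imp p q => sat I e p -> sat I e q
  | All p => forall x : M, sat I (scons x e) p
  end.

(* [phi(x; a)]: the object variable has index 0, and the parameters [a] fill the
   remaining indices, only finitely many of which occur in [phi]. *)
Definition sat1 L M (I : interpretation L M) (phi : formula L) (x : M)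
  (a : nat -> M) : Prop := sat I (scons x a) phi.

(* Definable with parameters. *)
Definition definable L M (I : interpretation L M) (A : set M) : Prop :=
  exists (phi : formula L) (a : nat -> M), A = [set x | sat1 I phi x a].

Definition elementary_embedding L M N (I : interpretation L M)
    (J : interpretation L N) (h : M -> N) : Prop :=
  forall (phi : formula L) (e : nat -> M), sat I e phi <-> sat J (h \o e) phi.

(** * Burden *)

(* An inp-pattern of depth [|K|] in one variable, with parameters in [N] and
   paths realized in [N]. *)
Definition inp_pattern L N (J : interpretation L N) (K : Type)
    (phi : K -> formula L) (k : K -> nat) (a : K -> nat -> nat -> N) : Prop :=
  (forall (i : K) (s : seq nat), uniq s -> size s = k i ->
     ~ exists x : N, forall j, j \in s -> sat1 J (phi i) x (a i j))
  /\
  (forall eta : K -> nat,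
     exists x : N, forall i : K, sat1 J (phi i) x (a i (eta i))).

(* The elementary extension [N] plays the role of the monster model. *)
Definition has_inp_pattern L M (I : interpretation L M) (K : Type) : Prop :=
  exists (N : Type) (J : interpretation L N) (h : M -> N),
    elementary_embedding I J h /\
    exists (phi : K -> formula L) (k : K -> nat) (a : K -> nat -> nat -> N),
      inp_pattern J phi k a.

(* The supremum of the depths is the cardinal [|kappa|]. *)
Definition has_burden L M (I : interpretation L M) (kappa : Type) : Prop :=
  (forall K : Type, has_inp_pattern I K -> [set: K] #<= [set: kappa])
  /\
  (forall mu : Type,
     (forall K : Type, has_inp_pattern I K -> [set: K] #<= [set: mu]) ->
     [set: kappa] #<= [set: mu]).

(** * Ordered Abelian groups and their expansions *)

(* A plain record rather than an HB structure: the join of [zmodType] and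
   [orderType] cannot be declared below the existing [realDomainType]. *)
Record oagType := OagType {
  oag_porderZmod : porderZmodType;
  oag_le_total : total (<=%R : rel oag_porderZmod);
  oag_ltrD2r : forall z x y : oag_porderZmod, x < y -> x + z < y + z }.

Definition oag_sort (R : oagType) : Type := oag_porderZmod R.
Coercion oag_sort : oagType >-> Sortclass.

HB.instance Definition _ (R : oagType) :=
  Num.POrderedZmodule.on (oag_sort R).
HB.instance Definition _ (R : oagType) :=
  Order.POrder_isTotal.Build ring_display (oag_sort R) (@oag_le_total R).

Definition divisible (R : zmodType) : Prop :=
  forall (n : nat) (x : R), (0 < n)%N -> exists y : R, y *+ n = x.

(* [L] together with a binary function symbol and a binary relation symbol
   (both [None]) for [+] and [<]. *)
Definition oag_language (L : language) : language := {|
  fsym := option (fsym L); farity := oapp (@farity L) 2;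
  rsym := option (rsym L); rarity := oapp (@rarity L) 2 |}.

Definition expansion L (R : oagType) (I : interpretation L R) :
    interpretation (oag_language L) R :=
  @Interpretation (oag_language L) R
    (fun f : option (fsym L) =>
       match f return ('I_(oapp (@farity L) 2 f) -> R) -> R with
       | None => fun v : 'I_2 -> R => v ord0 + v ord_max
       | Some g => @fint L R I g
       end)
    (fun r : option (rsym L) =>
       match r return ('I_(oapp (@rarity L) 2 r) -> R) -> Prop with
       | None => fun v : 'I_2 -> R => v ord0 < v ord_max
       | Some q => @rint L R I q
       end).

Definition definably_complete L (R : oagType) (I : interpretation L R) : Prop :=
  forall A : set R, definable I A -> A !=set0 -> has_ubound A ->
    supremums A !=set0.

(** * Discrete and pseudo-arithmetic sets *)

Definition discrete (R : oagType) (E : set R) : Prop :=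
  E `<=` @isolated (order_topology R) E.

Definition above (R : oagType) (E : set R) (a : R) : set R :=
  [set b | E b /\ a < b].

(* The set of minima of [above E a]: [[set S_E(a)]] if the minimum exists,
   [set0] otherwise. *)
Definition successors (R : oagType) (E : set R) (a : R) : set R :=
  above E a `&` lbound (above E a).

Definition differences (R : oagType) (E : set R) : set R :=
  [set d | exists a b, [/\ E a, successors E a b & d = b - a]].

(* The second clause says that [S_E(a)] is defined for each non-maximal [a]; a
   discrete set such as [{-1} `|` {1/n : n > 0}] in the rationals fails it. *)
Definition pseudo_arithmetic (R : oagType) (E : set R) : Prop :=
  [/\ discrete E,
      forall a, E a -> above E a !=set0 -> successors E a !=set0
    & exists g : R, differences E = [set g]].

(* Main.v *)
Require Import Defs.
From mathcomp Require Import all_boot all_order all_algebra.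
From mathcomp Require Import all_classical.
From mathcomp Require Import order_topology.
Set Implicit Arguments.
Unset Strict Implicit.
Unset Printing Implicit Defensive.
Import Order.TTheory GRing.Theory.
Local Open Scope classical_set_scope.
Local Open Scope card_scope.
Local Open Scope ring_scope.

(** Everything rests on one way of building inp-patterns of depth 3. If [A] and
    [B] are uniformly definable, and the points [a_i] of [A] and [b_j] of [B]
    form large finite grids [a_i + b_j] such that [a_i] is the largest point of
    [A] below [a_i + b_j + w] and [b_j] is the largest point of [B] below
    [b_j + w], for small [w >= 0], then [a_i], [b_j] and [w] can be read off
    [a_i + b_j + w] and prescribed independently; by compactness the burden is
    at least 3.
    - An accumulation point [c] of [D] gives such a grid with [A = D] and
      [B = D - c]. So bounded definable subsets of [D] have extrema.
    - Infinitely many distances between successive points of [D] give one with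
      [A = D], where [B] is the set of these distances in a bounded part of [D].
      So [D] is coded by words over a finite alphabet.
    - If, for each [n], some finite word occurs infinitely often in [D] without
      recurring within [n] steps, there is one where [A] is the set of
      occurrences of that word and [B] is a translate of [D]. So there is an [n]
      such that, for each [k], all but finitely many points start a word of
      length [k] recurring within [n] steps. For [k = n!] this implies that the
      gaps at [d] and at the [n!]-th successor of [d] agree for all but finitely
      many [d].
    Cutting [D] at the finitely many exceptions leaves pieces which split into
    classes with constant differences. The classes need not be definable. *)

(** * The ultrapower and inp-patterns *)

Section Ultrapower.
Variables (L : language) (M : Type) (I : interpretation L M).
Variable U : set_system nat.
Hypothesis UU : UltraFilter U.

#[local] Instance ultra_filter : Filter U := @filter_filter _ _ ultra_proper.

Definition ueq (f g : nat -> M) : Prop := U [set n | f n = g n].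

(** Elements are equivalence classes of sequences, as sets; [urep] chooses a representative. *)
Definition upow : Type := {C : set (nat -> M) | exists f, C = ueq f}.

Definition ucls (f : nat -> M) : upow := exist _ (ueq f) (ex_intro _ f erefl).

Definition urep (c : upow) : nat -> M := projT1 (cid (projT2 c)).

Lemma ueq_refl f : ueq f f.
Proof. by apply: filterS filterT => n. Qed.

Lemma ucls_eq f g : ucls f = ucls g <-> ueq f g.
Proof.
rewrite /ucls; split=> [[->]|fg]; first exact: ueq_refl.
apply: eq_exist; apply/funext => h; apply/propext; split => H;
  by apply: filterS2 fg H => n /= -> ->.
Qed.

Lemma urepK c : ucls (urep c) = c.
Proof.
by case: c => C p; rewrite /ucls /urep /=; apply: eq_exist; case: cid.
Qed.

Lemma urep_cls f : ueq (urep (ucls f)) f.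
Proof. by apply/ucls_eq; rewrite urepK. Qed.

Definition uinterp : interpretation L upow :=
  @Interpretation L upow
    (fun f v => ucls (fun n => fint I (fun i => urep (v i) n)))
    (fun r v => U [set n | rint I (r := r) (fun i => urep (v i) n)]).

Lemma eval_uinterp (F : nat -> nat -> M) (t : term L) :
  eval uinterp (fun i => ucls (F i)) t =
  ucls (fun n => eval I (fun i => F i n) t).
Proof.
elim: t => [//|f ts IH] /=; apply/ucls_eq.
pose ev i n := eval I (fun j => F j n) (ts i).
have : U [set n | forall i, urep (ucls (ev i)) n = ev i n].
  by apply: filter_forall => i; exact: urep_cls.
apply: filterS => n /= H; congr fint; apply/funext => i.
by rewrite IH H.
Qed.

Lemma ultraNP (A : set nat) : U (~` A) <-> ~ U A.
Proof.
split=> [nA UA|nA]; last by have [] := in_ultra_setVsetC A UU.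
by have /filter_ex [n []] : U (A `&` ~` A) by exact: filterI.
Qed.

(** Los's theorem, by induction on the formula: [Imp] uses that [U] is ultra, [All] chooses a
    counterexample index by index. *)
Lemma los (phi : formula L) (F : nat -> nat -> M) :
  sat uinterp (fun i => ucls (F i)) phi <->
  U [set n | sat I (fun i => F i n) phi].
Proof.
elim: phi F => [s t|r ts||p IHp q IHq|p IHp] F /=.
- by rewrite !eval_uinterp ucls_eq.
- pose ev i n := eval I (fun j => F j n) (ts i).
  have H : U [set n | forall i, urep (ucls (ev i)) n = ev i n].
    by apply: filter_forall => i; exact: urep_cls.
  have E n : (forall i, urep (ucls (ev i)) n = ev i n) ->
      (fun i => urep (eval uinterp (fun i => ucls (F i)) (ts i)) n) = ev^~ n.
    by move=> En; apply/funext => i; rewrite eval_uinterp En.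
  by split => H'; apply: filterS2 H H' => n /= /E ->.
- by split=> //; rewrite (_ : [set _ | _] = set0) ?predeqE// =>
  /filter_not_empty.
- rewrite IHp IHq; split=> [pq|pq Up]; last first.
    by apply: filterS2 pq Up => n /= pq /pq.
  have [Up|nUp] := pselect (U [set n | sat I (fun i => F i n) p]).
    by apply: filterS (pq Up) => n /= + _.
  by move/ultraNP: nUp; apply: filterS => n /= np /np.
- have sc f : (fun i => ucls (scons f F i)) = scons (ucls f) (fun i =>
  ucls (F i)).
    by apply/funext => -[].
  have scn f n : (fun i => scons f F i n) = scons (f n) (fun i => F i n).
    by apply/funext => -[].
  split=> [H|H c].
    apply: contrapT => /ultraNP; set B := ~` _ => UB.
    pose f n := if pselect (exists x, ~ sat I (scons x (fun i => F i n)) p)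
                is left e then projT1 (cid e) else F 0%N n.
    have := H (ucls f); rewrite -sc IHp.
    move=> /(filterI UB) /filter_ex [n] [nB] /=; rewrite scn /f.
    case: pselect => [e|+ _]; first by case: cid.
    by move=> ne; apply: nB => x; apply: contrapT => nx; apply: ne; exists x.
  rewrite -(urepK c) -sc IHp; apply: filterS H => n /= /(_ (urep c n)).
  by rewrite scn.
Qed.

End Ultrapower.

(** * From finite arrays to inp-patterns *)

(** Compactness: in an ultrapower along an ultrafilter containing the cofinite sets, arrays of all
    finite sizes glue to an infinite one with 2-inconsistent rows. *)
Lemma finite_inp_pattern L M (I : interpretation L M) (K : finType)
    (phi : K -> formula L) :
  (forall n : nat, exists a : K -> nat -> nat -> M,
     (forall i j j' x, (j < n)%N -> (j' < n)%N -> j <> j' ->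
        sat1 I (phi i) x (a i j) -> sat1 I (phi i) x (a i j') -> False) /\
     (forall eta : K -> nat, (forall i, (eta i < n)%N) ->
        exists x, forall i, sat1 I (phi i) x (a i (eta i)))) ->
  has_inp_pattern I K.
Proof.
move=> H; have {H} [a aP] := choice H.
have [U [UU oU]] := @ultraFilterLemma nat \oo _.
have UF : Filter U by apply: @filter_filter.
exists (upow M U), (uinterp I U), (fun x => ucls U (fun=> x)); split.
  move=> psi e; rewrite (los _ _ psi (fun i _ => e i)).
  split=> H; first by apply: filterS filterT => n.
  by have /filter_ex [n] := H.
exists phi, (fun=> 2), (fun i j l => ucls U (fun n => a n i j l)).
have satE i j f : sat1 (uinterp I U) (phi i) (ucls U f)
    (fun l => ucls U (fun n => a n i j l)) <->
    U [set n | sat1 I (phi i) (f n) (a n i j)].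
  rewrite /sat1 (_ : scons _ _ =
    fun l => ucls U (scons f (fun l n => a n i j l) l)); last first.
    by apply/funext => -[].
  rewrite los; split; apply: filterS => n /=; congr sat;
    by apply/funext => -[].
split.
  move=> i [|j [|j' []]]// + _ [c H].
  rewrite /= inE andbT => /eqP jj'.
  have := H j; have := H j'; rewrite !inE !eqxx orbT =>
    /(_ isT) Hj' /(_ isT) Hj.
  move: Hj Hj'; rewrite -(urepK c) !satE => Hj Hj'.
  have Uj : U [set n | (maxn j j' < n)%N] by apply: oU; exists (maxn j j').+1.
  have /filter_ex [n [[Hn1 Hn2] /= Hn3]] := @filterI _ U UF _ _ (@filterI _ U
    UF _ _ Hj Hj') Uj.
  have [aP1 _] := aP n.
  apply: aP1 Hn1 Hn2 => //; rewrite gtn_max in Hn3; by case/andP: Hn3.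
move=> eta; pose m := \max_i eta i.
have ltm i n : (m < n)%N -> (eta i < n)%N by apply: leq_ltn_trans;
  exact: leq_bigmax.
have ex n : (m < n)%N -> exists x, forall i, sat1 I (phi i) x (a n i (eta i)).
  by move=> mn; have [_] := aP n; apply => i; exact: ltm.
have [x0 _] := ex m.+1 (ltnSn m).
(* The path is realized in every array of size above [m], the largest entry of [eta]; [x0] fills the
   finitely many other places. *)
pose f n := if pselect (m < n)%N is left lt then projT1 (cid (ex n lt)) else x0.
exists (ucls U f) => i; rewrite satE.
apply: (@filterS _ U _ [set n | (m < n)%N]); last by apply: oU; exists m.+1.
by move=> n /= lt; rewrite /f; case: pselect => // lt'; case: cid.
Qed.

Lemma burden_finite_inp_pattern L M (I : interpretation L M) (k m : nat)
    (phi : 'I_m -> formula L) :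
  has_burden I 'I_k ->
  (forall n : nat, exists a : 'I_m -> nat -> nat -> M,
     (forall i j j' x, (j < n)%N -> (j' < n)%N -> j <> j' ->
        sat1 I (phi i) x (a i j) -> sat1 I (phi i) x (a i j') -> False) /\
     (forall eta : 'I_m -> nat, (forall i, (eta i < n)%N) ->
        exists x, forall i, sat1 I (phi i) x (a i (eta i)))) ->
  (m <= k)%N.
Proof.
move=> [H _] /finite_inp_pattern /H.
have Ic n : [set: 'I_n] #= `I_n by rewrite card_eq_sym; exact: card_II.
by rewrite (card_le_eql (Ic m)) (card_le_eqr (Ic k)) card_le_II.
Qed.

(** * Relations definable with parameters *)

Fixpoint tren L (f : nat -> nat) (t : term L) : term L :=
  match t with
  | Var n => Var (f n)
  | App g ts => App (fun i => tren f (ts i))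
  end.

Definition up (f : nat -> nat) (n : nat) : nat :=
  if n is n'.+1 then (f n').+1 else 0%N.

Fixpoint ren L (f : nat -> nat) (phi : formula L) : formula L :=
  match phi with
  | Eq s t => Eq (tren f s) (tren f t)
  | Rel r ts => Rel (fun i => tren f (ts i))
  | Bot => Bot
  | Imp p q => Imp (ren f p) (ren f q)
  | All p => All (ren (up f) p)
  end.

Lemma eval_tren L M (I : interpretation L M) e f (t : term L) :
  eval I e (tren f t) = eval I (e \o f) t.
Proof.
by elim: t => //= g ts IH; congr fint; apply/funext => i; rewrite IH.
Qed.

Lemma sat_ren L M (I : interpretation L M) e f (phi : formula L) :
  sat I e (ren f phi) <-> sat I (e \o f) phi.
Proof.
elim: phi e f => [s t|r ts||p IHp q IHq|p IHp] e f //=.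
- by rewrite !eval_tren.
- by under eq_fun do rewrite eval_tren.
- by rewrite IHp IHq.
- have E x : scons x e \o up f = scons x (e \o f) by apply/funext => -[].
  by split=> H x; have := H x; rewrite IHp E.
Qed.

(* Variables at even indices, parameters at odd ones. *)
Definition mix M (e a : nat -> M) (n : nat) : M :=
  if odd n then a n./2 else e n./2.

(** Two formulas get a common parameter sequence [mix a b]: [mixl] and [mixr] redirect parameter
    indices to its even and odd entries. *)
Definition mixl (n : nat) : nat := if odd n then (n./2.*2).*2.+1 else n.
Definition mixr (n : nat) : nat := if odd n then (n./2.*2.+1).*2.+1 else n.

Lemma mixlE M (e a b : nat -> M) : mix e (mix a b) \o mixl = mix e a.
Proof.
apply/funext => n; rewrite /= /mix /mixl; case on: (odd n); last by rewrite on.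
by rewrite /= odd_double /= uphalf_double odd_double /= doubleK.
Qed.

Lemma mixrE M (e a b : nat -> M) : mix e (mix b a) \o mixr = mix e a.
Proof.
apply/funext => n; rewrite /= /mix /mixr; case on: (odd n); last by rewrite on.
by rewrite /= odd_double /= uphalf_double /= odd_double /= uphalf_double.
Qed.

Section Definability.
Variables (L : language) (R : oagType) (I0 : interpretation L R).
Let LL := oag_language L.
Let I := expansion I0.

(* A relation of any arity is a predicate on valuations of the variables. *)
Definition definable_pred (P : (nat -> R) -> Prop) : Prop :=
  exists (phi : formula LL) (a : nat -> R),
    forall e, P e <-> sat I (mix e a) phi.

Definition definable_term (t : (nat -> R) -> R) : Prop :=
  exists (s : term LL) (a : nat -> R), forall e, t e = eval I (mix e a) s.

Lemma definable_ext (P Q : (nat -> R) -> Prop) :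
  (forall e, P e <-> Q e) -> definable_pred P -> definable_pred Q.
Proof. by move=> PQ [phi [a H]]; exists phi, a => e; rewrite -PQ. Qed.

Lemma definable_term_var i : definable_term (fun e => e i).
Proof.
by exists (Var i.*2), (fun=> 0) => e /=; rewrite /mix odd_double doubleK.
Qed.

Lemma definable_term_cst c : definable_term (fun=> c).
Proof. by exists (Var 1), (fun=> c) => e. Qed.

Lemma term_common_params t1 t2 : definable_term t1 -> definable_term t2 ->
  exists (s1 s2 : term LL) (a : nat -> R),
  (forall e, t1 e = eval I (mix e a) s1) /\
  (forall e, t2 e = eval I (mix e a) s2).
Proof.
move=> [s1 [a1 H1]] [s2 [a2 H2]].
exists (tren mixl s1), (tren mixr s2), (mix a1 a2).
by split=> e; rewrite eval_tren ?mixlE ?mixrE.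
Qed.

Lemma definable_common_params P Q : definable_pred P -> definable_pred Q ->
  exists (p q : formula LL) (a : nat -> R),
  (forall e, P e <-> sat I (mix e a) p) /\ (forall e, Q e <-> sat I (mix e a)
    q).
Proof.
move=> [s1 [a1 H1]] [s2 [a2 H2]].
exists (ren mixl s1), (ren mixr s2), (mix a1 a2).
by split=> e; rewrite sat_ren ?mixlE ?mixrE.
Qed.

Lemma definable_term_add t1 t2 : definable_term t1 -> definable_term t2 ->
  definable_term (fun e => t1 e + t2 e).
Proof.
move=> /term_common_params /[apply] -[s1 [s2 [a [H1 H2]]]].
exists (@App LL None (fun i : 'I_2 => if i == ord0 then s1 else s2)), a => e /=.
by rewrite H1 H2.
Qed.

Lemma definable_lt t1 t2 : definable_term t1 -> definable_term t2 ->
  definable_pred (fun e => t1 e < t2 e).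
Proof.
move=> /term_common_params /[apply] -[s1 [s2 [a [H1 H2]]]].
exists (@Rel LL None (fun i : 'I_2 => if i == ord0 then s1 else s2)), a => e /=.
by rewrite H1 H2.
Qed.

Lemma definable_eq t1 t2 : definable_term t1 -> definable_term t2 ->
  definable_pred (fun e => t1 e = t2 e).
Proof.
move=> /term_common_params /[apply] -[s1 [s2 [a [H1 H2]]]].
by exists (Eq s1 s2), a => e /=; rewrite H1 H2.
Qed.

Lemma definable_imp P Q : definable_pred P -> definable_pred Q ->
  definable_pred (fun e => P e -> Q e).
Proof.
move=> /definable_common_params /[apply] -[s1 [s2 [a [H1 H2]]]].
by exists (Imp s1 s2), a => e /=; rewrite H1 H2.
Qed.

Lemma definable_False : definable_pred (fun=> False).
Proof. by exists Bot, (fun=> 0) => e. Qed.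

Lemma definable_not P : definable_pred P -> definable_pred (fun e => ~ P e).
Proof. by move=> dP; apply: definable_imp => //; exact: definable_False. Qed.

Lemma definable_and P Q : definable_pred P -> definable_pred Q ->
  definable_pred (fun e => P e /\ Q e).
Proof.
move=> dP dQ; have := definable_not (definable_imp dP (definable_not dQ)).
by apply: definable_ext => e; split=> [H|[p q] H]; [apply: contrapT;
  tauto|tauto].
Qed.

Lemma definable_le t1 t2 : definable_term t1 -> definable_term t2 ->
  definable_pred (fun e => t1 e <= t2 e).
Proof.
move=> T1 T2; apply: definable_ext (definable_not (definable_lt T2 T1)) => e.
by rewrite leNgt; split => /negP.
Qed.

Lemma definable_iff P Q : definable_pred P -> definable_pred Q ->
  definable_pred (fun e => P e <-> Q e).
Proof. by move=> dP dQ; apply: definable_and; apply: definable_imp. Qed.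

(** A bound variable enters at index 0 and shifts all others, exchanging parities; [pull] restores
    the layout of [mix] with it as first variable. *)
Definition pull (n : nat) : nat :=
  if odd n then n.+1 else if n is n'.+2 then n'.+1 else 0%N.

Lemma pullE (x : R) e a : scons x (mix e a) \o pull = mix (scons x e) a.
Proof.
apply/funext => n; rewrite /= /mix /pull; case on: (odd n) => /=.
  by rewrite on; case: n on.
by case: n on => [//|[//|n]] /=; rewrite negbK => ->.
Qed.

Lemma definable_all P :
  definable_pred (fun e => P (e 0%N) (fun i => e i.+1)) ->
    definable_pred (fun e => forall x, P x e).
Proof.
move=> [phi [a H]]; exists (All (ren pull phi)), a => e /=.
split=> K x; have := K x; rewrite sat_ren pullE; have := H (scons x e); tauto.
Qed.

Lemma definable_ex P :
  definable_pred (fun e => P (e 0%N) (fun i => e i.+1)) ->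
    definable_pred (fun e => exists x, P x e).
Proof.
move=> dP; have := definable_not (@definable_all (fun x e =>
  ~ P x e) (definable_not dP)).
apply: definable_ext => e; split => [H|[x p] /(_ x)//].
by apply: contrapT => H'; apply: H => x p; apply: H'; exists x.
Qed.

Definition mixren (f : nat -> nat) n := if odd n then n else (f n./2).*2.

Lemma definable_ren P (f : nat -> nat) : definable_pred P ->
  definable_pred (fun e => P (fun i => e (f i))).
Proof.
move=> [phi [a H]]; exists (ren (mixren f) phi), a => e.
rewrite H sat_ren (_ : _ \o _ = mix (fun i => e (f i)) a)//.
apply/funext => n; rewrite /= /mix /mixren; case on: (odd n);
  first by rewrite on.
by rewrite odd_double doubleK.
Qed.

Lemma definable_term_ren t (f : nat -> nat) : definable_term t ->
  definable_term (fun e => t (fun i => e (f i))).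
Proof.
move=> [s [a H]]; exists (tren (mixren f) s), a => e.
rewrite H eval_tren (_ : _ \o _ = mix (fun i => e (f i)) a)//.
apply/funext => n; rewrite /= /mix /mixren; case on: (odd n);
  first by rewrite on.
by rewrite odd_double doubleK.
Qed.

Lemma definableE (X : set R) : definable I X <-> definable_pred (fun e =>
  X (e 0%N)).
Proof.
split=> [[phi [a ->]]|[phi [a H]]].
  exists (ren (fun n => if n is n'.+1 then n'.*2.+1 else 0%N) phi), a => e /=.
  rewrite sat_ren /sat1 (_ : _ \o _ = scons (e 0%N) a)//.
  by apply/funext => -[|n] //=; rewrite /mix /= odd_double uphalf_double.
exists (ren pull phi), (mix (fun=> 0) a); apply/funext => x /=; apply/propext.
by rewrite /sat1 sat_ren pullE -H.
Qed.

(** Instead of substituting [t] in a formula for [X], quantify over a point equal to [t]. *)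
Lemma definable_set (X : set R) t : definable_pred (fun e => X (e 0%N)) ->
  definable_term t ->
  definable_pred (fun e => X (t e)).
Proof.
move=> dX dt.
have : definable_pred (fun e => exists y, y = t e /\ X y).
  apply: definable_ex; apply: definable_and => //; apply: definable_eq;
    first exact: definable_term_var.
  exact: definable_term_ren dt.
by apply: definable_ext => e; split => [[y [->]]//|]; exists (t e).
Qed.

(** Serves for uniform families of sets: three parameters, then a point. *)
Definition definable4 (A : R -> R -> R -> R -> Prop) : Prop :=
  definable_pred (fun e => A (e 0%N) (e 1%N) (e 2%N) (e 3%N)).

Lemma definable_rel4 A i j k l : definable4 A -> definable_pred (fun e =>
  A (e i) (e j) (e k) (e l)).
Proof.
exact: (@definable_ren _ (fun n => nth 0%N [:: i; j; k; l] n)).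
Qed.

Definition definable2 (A : R -> R -> Prop) : Prop := definable_pred (fun e =>
  A (e 0%N) (e 1%N)).

Lemma definable_rel2 A i j : definable2 A -> definable_pred (fun e =>
  A (e i) (e j)).
Proof. exact: (@definable_ren _ (fun n => nth 0%N [:: i; j] n)). Qed.

End Definability.

Ltac prove_definable := repeat first
  [ exact: definable_term_var | exact: definable_term_cst | apply:
    definable_term_add
  | eassumption
  | apply: definable_rel4; assumption
  | apply: definable_rel2; assumption
  | apply: definable_set; [assumption|]
  | apply: definable_lt | apply: definable_le | apply: definable_eq
  | apply: definable_all | apply: definable_ex
  | apply: definable_and | apply: definable_iff | apply: definable_not | apply:
    definable_imp ].

(** * Ordered groups and grids *)

Section OrderedGroup.
Variable R : oagType.
Implicit Types x y z t c : R.

Lemma oltD2r z x y : (x + z < y + z) = (x < y).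
Proof.
apply/idP/idP => [|/oag_ltrD2r]; last exact.
by move=> /(@oag_ltrD2r R (- z)); rewrite !addrK.
Qed.

Lemma oltD2l z x y : (z + x < z + y) = (x < y).
Proof. by rewrite ![z + _]addrC oltD2r. Qed.

Lemma oleD2r z x y : (x + z <= y + z) = (x <= y).
Proof. by rewrite !leNgt oltD2r. Qed.

Lemma oleD2l z x y : (z + x <= z + y) = (x <= y).
Proof. by rewrite !leNgt oltD2l. Qed.

Lemma osub_gt0 x y : (0 < y - x) = (x < y).
Proof. by rewrite -(oltD2r x 0) add0r subrK. Qed.

Lemma osub_ge0 x y : (0 <= y - x) = (x <= y).
Proof. by rewrite -(oleD2r x 0) add0r subrK. Qed.

Lemma oltDl x t : (x < x + t) = (0 < t).
Proof. by rewrite -{1}[x]addr0 oltD2l. Qed.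

Lemma oleDl x t : (x <= x + t) = (0 <= t).
Proof. by rewrite -{1}[x]addr0 oleD2l. Qed.

Lemma oltBlD x y z : (y - x < z) = (y < x + z).
Proof. by rewrite -(oltD2l x (y - x)) addrC subrK. Qed.

Lemma oleBlD x y z : (y - x <= z) = (y <= x + z).
Proof. by rewrite -(oleD2l x (y - x)) addrC subrK. Qed.

Lemma oltN2 x y : (- x < - y) = (y < x).
Proof. by rewrite -(oltD2r (x + y) (- x)) addKr addrCA addNr addr0. Qed.

Lemma oleN2 x y : (- x <= - y) = (y <= x).
Proof. by rewrite !leNgt oltN2. Qed.

Lemma half_exists t : divisible R -> 0 < t -> exists h : R, 0 < h < t.
Proof.
move=> /(_ 2 t isT) [h <-] t0; rewrite mulr2n in t0 *.
have h0 : 0 < h.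
  rewrite ltNge; apply/negP => h0; move: t0; rewrite ltNge.
  by rewrite (le_trans _ h0)// -[leRHS]addr0 oleD2l.
by exists h; rewrite h0 oltDl.
Qed.

Lemma decreasing_seq (P : R -> Prop) c t :
  (forall t, c < t -> exists x, P x /\ c < x < t) -> c < t ->
  exists f : nat -> R, injective f /\ forall k, P (f k) /\ c < f k < t.
Proof.
move=> H ct.
have /choice [g gP] : forall t, exists x, c < t -> P x /\ c < x < t.
  move=> t'; have [lt|] := boolP (c < t'); last by exists 0.
  by have [x] := H _ lt; exists x.
(* Starting at [k.+1] leaves out [t] itself, which need not satisfy [P]. *)
pose f k := iter k.+1 g t.
have f0 k : c < iter k g t by elim: k => //= k IH; have [_ /andP[]] := gP _ IH.
have fS k : iter k.+1 g t < iter k g t by have [_ /andP[]] := gP _ (f0 k).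
have dec m n : (m < n)%N -> iter n g t < iter m g t.
  elim: n => // n IH; rewrite ltnS leq_eqVlt => /predU1P [->//|/IH].
  exact: lt_trans.
exists f; split => [m n E|k].
  have [lt|lt|//] := ltngtP m n.
    by have := dec m.+1 n.+1 lt; rewrite -/(f m) -/(f n) E ltxx.
  by have := dec n.+1 m.+1 lt; rewrite -/(f m) -/(f n) E ltxx.
by split; [have [] := gP _ (f0 k)|rewrite f0 (dec 0%N)].
Qed.

Lemma small_seq t : divisible R -> 0 < t ->
  exists f : nat -> R, injective f /\ forall k, 0 < f k < t.
Proof.
move=> divR /(@decreasing_seq (fun=> True)) [].
  by move=> t' /(half_exists divR) [h ?]; exists h.
by move=> f [inj fP]; exists f; split => // k; have [] := fP k.
Qed.

(** Take the least of the [n] radii; for [n = 0] any positive element does. *)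
Lemma common_radius (n : nat) (P : nat -> R -> Prop) :
  (exists t : R, 0 < t) ->
  (forall i t t', P i t -> 0 < t' -> t' <= t -> P i t') ->
  (forall i, (i < n)%N -> exists t : R, 0 < t /\ P i t) ->
  exists t : R, 0 < t /\ forall i, (i < n)%N -> P i t.
Proof.
move=> [t0 t0P] mono; elim: n => [|n IH] H; first by exists t0.
have [i /ltnW lt|t [tP tH]] := IH; first exact: H.
have [t' [t'P t'H]] := H n (ltnSn n).
exists (Order.min t t'); split; first by rewrite lt_min tP.
move=> i; rewrite ltnS leq_eqVlt => /predU1P [->|/tH Pt].
  by apply: mono t'H _ _; rewrite ?lt_min ?tP// ge_min lexx orbT.
by apply: mono Pt _ _; rewrite ?lt_min ?tP// ge_min lexx.
Qed.

Definition floor_in (A : R -> Prop) (a x : R) : Prop :=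
  A a /\ a <= x /\ (forall y, A y -> a < y -> x < y).

Lemma floor_in_uniq A a a' x : floor_in A a x -> floor_in A a' x -> a = a'.
Proof.
move=> [Aa [ax aP]] [Aa' [ax' aP']]; have [lt|lt|//] := ltgtP a a'.
  by have := aP _ Aa' lt; rewrite ltNge ax'.
by have := aP' _ Aa lt; rewrite ltNge ax.
Qed.

End OrderedGroup.

(** * Grids and patterns of depth 3 *)

Section Grid.
Variables (L : language) (R : oagType) (I0 : interpretation L R).
Let I := expansion I0.
Hypotheses (divR : divisible R) (burden2 : has_burden I 'I_2).

Lemma finite_patterns3 (P : 'I_3 -> (nat -> R) -> Prop) :
  (forall i, definable_pred I0 (P i)) ->
  (forall n : nat, exists a : 'I_3 -> nat -> nat -> R,
     (forall i j j' x, (j < n)%N -> (j' < n)%N -> j <> j' ->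
        P i (scons x (a i j)) -> P i (scons x (a i j')) -> False) /\
     (forall eta : 'I_3 -> nat, (forall i, (eta i < n)%N) ->
        exists x, forall i, P i (scons x (a i (eta i))))) ->
  False.
Proof.
move=> /choice [phi] /choice [c phiP] H.
suff : (3 <= 2)%N by [].
apply: (burden_finite_inp_pattern (phi := fun i =>
  ren pull (phi i)) burden2) => n.
have [a [a1 a2]] := H n.
have E i x e : sat1 I (ren pull (phi i)) x (mix e (c i)) <-> P i (scons x e).
  by rewrite /sat1 sat_ren pullE -phiP.
exists (fun i j => mix (a i j) (c i)); split.
  by move=> i j j' x lj lj' ne /E h /E; apply: a1 h.
by move=> eta /a2 [x xP]; exists x => i; apply/E.
Qed.

(* The pattern of depth 3 has as rows the conditions fixing [u], [v] and [w] in
   the decomposition [x = u + v + w], where [u] is the floor of [x] in [A] and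
   [v] is the floor of [x - u] in [B]; density provides the values of [w]. *)
Lemma no_grid (A B : R -> R -> R -> R -> Prop) :
  definable4 I0 A -> definable4 I0 B ->
  (forall n : nat, exists (p q r s : R) (a b : nat -> R),
     [/\ forall i j, (i < n)%N -> (j < n)%N -> a i = a j -> i = j,
         forall i j, (i < n)%N -> (j < n)%N -> b i = b j -> i = j,
         forall i, (i < n)%N -> A p q r (a i) /\
           forall y, A p q r y -> a i < y -> a i + s <= y
       & forall i, (i < n)%N -> [/\ B p q r (b i), 0 <= b i < s &
           exists t : R, 0 < t /\ forall y, B p q r y -> b i < y ->
             b i + t <= y]]) ->
  False.
Proof.
move=> defA defB H.
pose P0 (e : nat -> R) := floor_in (A (e 2) (e 3) (e 4)) (e 1%N) (e 0%N).
pose P1 (e : nat -> R) := exists u z : R, e 0%N = u + z /\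
  floor_in (A (e 2) (e 3) (e 4)) u (e 0%N) /\
  floor_in (B (e 2) (e 3) (e 4)) (e 1%N) z.
pose P2 (e : nat -> R) := exists u v z : R, e 0%N = u + z /\
  floor_in (A (e 2) (e 3) (e 4)) u (e 0%N) /\
  floor_in (B (e 2) (e 3) (e 4)) v z /\ z = v + e 1%N.
apply: (@finite_patterns3 (fun i => nth P0 [:: P0; P1; P2] i)).
  by case=> [[|[|[|//]]] ?] /=; rewrite /P0 /P1 /P2 /floor_in; prove_definable.
case=> [|n].
  by exists (fun _ _ _ => 0); split => // eta /(_ ord0).
have [p [q [r [s [a [b [inja injb aP bP]]]]]]] := H n.+1.
have s0 : 0 < s by have [_ /andP[h1 h2] _] := bP 0%N isT; exact: le_lt_trans h2.
(* All values of [w] will lie below one [t], so that no [b j + w] reaches [s] or the next point of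
   [B]. *)
have [t [t0 tP]] : exists t : R, 0 < t /\ forall j, (j < n.+1)%N ->
  b j + t <= s /\
    forall y, B p q r y -> b j < y -> b j + t <= y.
  apply: common_radius; first by exists s.
    move=> i u u' [h1 h2] u0 lu; have le
      : b i + u' <= b i + u by rewrite oleD2l.
    split; first exact: le_trans h1.
    by move=> y yB /(h2 _ yB); apply: le_trans.
  move=> i /bP [Bi /andP[_ bs] [u [u0 uP]]].
  exists (Order.min u (s - b i)); rewrite lt_min u0 osub_gt0 bs; split => //.
  split; first by rewrite addrC -[leRHS](subrK (b i)) oleD2r ge_min lexx orbT.
  move=> y yB /(uP _ yB); apply: le_trans.
  by rewrite oleD2l ge_min lexx.
have [w [injw wP]] := small_seq divR t0.
pose f (i : 'I_3) := nth a [:: a; b; w] i.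
(* Index 1 of the valuation is the entry of the row; indices 2 to 4 hold the common parameters. *)
exists (fun i j => nth 0 [:: f i j; p; q; r]); split.
  case=> [[|[|[|//]]] ?] j j' x lj lj' ne /=; rewrite /P0 /P1 /P2 /f /=.
  - by move=> F F'; apply: ne; apply: inja => //; exact: floor_in_uniq F F'.
  - move=> [u [z [Ez [Fu Fz]]]] [u' [z' [Ez' [Fu' Fz']]]].
    have E := floor_in_uniq Fu Fu'; subst u'.
    have E : z = z' by apply: (addrI u); rewrite -Ez.
    by subst z'; apply: ne; apply: injb => //; exact: floor_in_uniq Fz Fz'.
  - move=> [u [v [z [Ez [Fu [Fv Ev]]]]]] [u' [v' [z' [Ez' [Fu' [Fv' Ev']]]]]].
    have E := floor_in_uniq Fu Fu'; subst u'.
    have E : z = z' by apply: (addrI u); rewrite -Ez.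
    rewrite -{z' Ez'}E in Fv' Ev'; have E := floor_in_uniq Fv Fv'; subst v'.
    by apply: ne; apply: injw; apply: (addrI v); rewrite -Ev.
move=> eta lt_eta.
pose i0 : 'I_3 := ord0; pose i1 : 'I_3 := Ordinal (isT : (1 < 3)%N).
pose i2 : 'I_3 := Ordinal (isT : (2 < 3)%N).
set u := a (eta i0); set v := b (eta i1); set y := w (eta i2).
have [Au uP] := aP _ (lt_eta i0); have [Bv /andP[v0 vs] _] := bP _ (lt_eta i1).
have [vt vP] := tP _ (lt_eta i1); have /andP[y0 yt] := wP (eta i2).
have vy : v + y < v + t by rewrite oltD2l.
have vy0 : 0 <= v + y by rewrite (le_trans v0)// oleDl ltW.
have Fu : floor_in (A p q r) u (u + (v + y)).
  split=> //; split; first by rewrite oleDl.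
  move=> z Az /(uP _ Az); apply: lt_le_trans; rewrite oltD2l.
  exact: lt_le_trans vt.
have Fv : floor_in (B p q r) v (v + y).
  split=> //; split; first by rewrite oleDl ltW.
  by move=> z Bz /(vP _ Bz); exact: lt_le_trans.
exists (u + (v + y)) => -[[|[|[|//]]] lti] /=; rewrite /P0 /P1 /P2 /f /=.
- by rewrite (_ : Ordinal lti = i0) //; exact: val_inj.
- rewrite (_ : Ordinal lti = i1) //; last exact: val_inj.
  by exists u, (v + y).
- rewrite (_ : Ordinal lti = i2) //; last exact: val_inj.
  by exists u, v, (v + y).
Qed.

End Grid.

(** * Definable discrete sets *)

Lemma infinite_seq (T : Type) (A : set T) : infinite_set A ->
  exists f : nat -> T, injective f /\ forall n, A (f n).
Proof.
move=> /infiniteP /card_leP [f]; exists (fun n => set_val (f (to_setT n))).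
split=> [m n /val_inj E|n]; last by have := set_valP (f (to_setT n)).
have := 'inj_f (mem_set I : to_setT m \in setT) (mem_set I
  : to_setT n \in setT) E.
by move/(congr1 val).
Qed.

Section Discrete.
Variable R : oagType.
Implicit Types (x y z t c : R) (D : set R).

(** Metric form of discreteness; [discrete_separated] derives it once a positive element exists. *)
Definition separated D : Prop := forall d, D d ->
  exists t : R, 0 < t /\ forall y, D y -> d - t < y -> y < d + t -> y = d.

(** The radius is the smaller distance from [x] to the ends, an infinite end contributing [t0]. *)
Lemma itv_open_ends_ball x t0 (i : interval R) : 0 < t0 ->
  itv_open_ends i -> x \in i ->
  exists t : R, 0 < t /\ forall y, x - t < y -> y < x + t -> y \in i.
Proof.
move=> t00; case: i => l r oi xi.
have [tl [tl0 tlP]] : exists t : R, 0 < t /\ forall y, x - t < y ->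
    (l <= BLeft y)%O.
  case: l oi xi => [[] l|[]] oi //; rewrite itv_boundlr => /andP[lx _];
    rewrite ?bnd_simp in lx; last by exists t0.
    exists (x - l); rewrite osub_gt0; split=> // y.
    by rewrite opprB addrC subrK bnd_simp.
have [tr [tr0 trP]] : exists t : R, 0 < t /\ forall y, y < x + t ->
    (BRight y <= r)%O.
  case: r oi xi => [b r|[]] oi; last 2 first.
  - by rewrite itv_boundlr andbF.
  - by exists t0.
  have {oi} -> : b = true by case: l b oi tlP => [[] ?|[]] [].
  rewrite itv_boundlr => /andP[_ xr]; rewrite bnd_simp in xr.
  exists (r - x); rewrite osub_gt0; split=> // y.
  by rewrite addrC subrK bnd_simp.
exists (Order.min tl tr); rewrite lt_min tl0 tr0; split=> // y yl yr.
rewrite itv_boundlr tlP ?trP//.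
  by apply: lt_le_trans yr _; rewrite oleD2l ge_min lexx orbT.
by apply: le_lt_trans yl; rewrite oleD2l oleN2 ge_min lexx.
Qed.

Lemma discrete_separated D t0 : 0 < t0 -> discrete D -> separated D.
Proof.
move=> t00 dD d /dD [_ [V]]; rewrite order_nbhs_itv => -[i [oi di] iV] VD.
have [t [t_gt0 tP]] := itv_open_ends_ball t00 oi di.
exists t; split=> // y Dy yl yr.
by have : (V `&` D) y; [split=> //; apply: iV; exact: tP|rewrite VD].
Qed.

Lemma discreteS D E : E `<=` D -> discrete D -> discrete E.
Proof.
move=> ED dD d Ed; split; first exact: mem_set.
have [_ [V nV VD]] := dD _ (ED _ Ed); exists V => //.
apply/seteqP; split=> [y [Vy /ED Dy]|_ ->]; first by rewrite -VD.
by split=> //; have : [set d] d by []; rewrite -VD => -[].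
Qed.

Lemma separated_above D d : separated D -> D d ->
  exists t : R, 0 < t /\ forall y, D y -> d < y -> d + t <= y.
Proof.
move=> sD /sD [t [t0 tP]]; exists t; split=> // y Dy dy.
rewrite leNgt; apply/negP => yt; move: (dy); rewrite (tP y) ?ltxx//.
by apply: le_lt_trans dy; rewrite oleBlD addrC oleDl ltW.
Qed.

Lemma separatedN D : separated D -> separated [set x | D (- x)].
Proof.
move=> sD d /= /sD [t [t0 tP]]; exists t; split=> // y /= Dy y1 y2.
apply/oppr_inj/tP => //.
  by rewrite -opprD oltN2.
by rewrite -oltN2 opprD !opprK.
Qed.

End Discrete.

(** * Extrema of definable subsets of discrete sets *)

Section DefinableDiscrete.
Variables (L : language) (R : oagType) (I0 : interpretation L R).
Let I := expansion I0.
Hypotheses (divR : divisible R) (burden2 : has_burden I 'I_2).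
Hypothesis dcR : definably_complete I.
Variable t0 : R.
Hypothesis t0_gt0 : 0 < t0.
Implicit Types D X : set R.

Local Notation definable1 X := (definable_pred I0 (fun e => X (e 0%N))).

(* Points [d_i] of [D] and points [e_j] much closer to the accumulation point
   [c] give a grid [d_i + (e_j - c)]. *)
Lemma no_right_accumulation D c : definable1 D -> separated D ->
  ~ forall t, c < t -> exists d, D d /\ c < d < t.
Proof.
move=> defD sD acc.
apply: (no_grid divR burden2 (A := fun _ _ _ x => D x)
  (B := fun _ _ _ y => D (c + y))); rewrite /definable4;
    first by prove_definable.
  by prove_definable.
move=> n.
have [|a [inja aP]] := @decreasing_seq _ _ _ (c + t0) acc;
  first by rewrite oltDl.
have [s [s0 sP]] : exists s : R, 0 < s /\ forall i, (i < n)%N ->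
    forall y, D y -> a i < y -> a i + s <= y.
  apply: common_radius; first by exists t0.
    by move=> i u u' H _ le y Dy /(H _ Dy); apply: le_trans; rewrite oleD2l.
  by move=> i _; have [Da _] := aP i; exact: separated_above.
have [|b [injb bP]] := @decreasing_seq _ _ _ (c + s) acc;
  first by rewrite oltDl.
exists 0, 0, 0, s, a, (fun i => b i - c); split.
- by move=> i j _ _; exact: inja.
- by move=> i j _ _ /addIr; exact: injb.
- by move=> i lin; split; [have [] := aP i|exact: sP].
- move=> i lin; have [Db /andP[bc bs]] := bP i.
  split; first by rewrite addrC subrK.
    by rewrite osub_ge0 ltW// oltBlD.
  have [t [t_gt0 tP]] := separated_above sD Db.
  exists t; split=> // y Dy; rewrite oltBlD => /(tP _ Dy).
  by rewrite addrAC oleBlD.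
Qed.

(** Negation need not be a term, so [- x] is described as the solution [y] of [y + x = 0]. *)
Lemma definable1_opp D : definable1 D -> definable1 [set x | D (- x)].
Proof.
move=> defD; have : definable_pred I0 (fun e => exists y
  : R, y + e 0%N = 0 /\ D y).
  by prove_definable.
apply: definable_ext => e /=; split=> [[y [/eqP]]|];
  first by rewrite addr_eq0 => /eqP ->.
by exists (- e 0%N); rewrite addNr.
Qed.

(** A supremum outside [X] would be approached from below by points of [D]; reflection turns this
    into the excluded accumulation from the right. *)
Lemma has_maximum D X (ub : R) : definable1 D -> separated D -> definable1 X ->
  X `<=` D ->
  X !=set0 -> ubound X ub -> exists m, X m /\ ubound X m.
Proof.
move=> defD sD defX XD X0 Xub.
have [m [mub mlub]] : supremums X !=set0.
  by apply: dcR => //; [exact/definableE|exists ub].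
exists m; split => //; apply: contrapT => nXm.
apply: (@no_right_accumulation [set x | D (- x)] (- m)).
- exact: definable1_opp.
- exact: separatedN.
move=> t mt; apply: contrapT => H.
suff /mlub : ubound X (- t) by rewrite -oleN2 opprK leNgt mt.
move=> x Xx; rewrite leNgt; apply/negP => tx; apply: H; exists (- x) => /=.
rewrite opprK; split; first exact: XD.
apply/andP; split; last by rewrite -[t]opprK oltN2.
rewrite oltN2 lt_neqAle mub// andbT.
by apply/eqP => E; rewrite E in Xx.
Qed.

Lemma has_minimum D X (lb : R) : definable1 D -> separated D -> definable1 X ->
  X `<=` D ->
  X !=set0 -> lbound X lb -> exists m, X m /\ lbound X m.
Proof.
move=> defD sD defX XD [x Xx] Xlb.
have [|y /= /Xlb|m [Xm mub]] := @has_maximum [set x | D (- x)] [set x | X (- x)]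
  (- lb) (definable1_opp defD) (separatedN sD) (definable1_opp defX) (fun y =>
    XD (- y)).
- by exists (- x); rewrite /= opprK.
- by rewrite -oleN2 opprK.
- by exists (- m); split=> // y Xy; rewrite -oleN2 opprK; apply: mub;
  rewrite /= opprK.
Qed.

(* A definable map on a bounded part of [D] behaves like a map on a finite set.
   The witness of isolation is the last of the successive minima of [v] above
   [g] along [D]. *)
Lemma image_right_isolated D (G : R -> R -> Prop) (lo hi g : R) :
  definable1 D -> separated D -> definable2 I0 G ->
  (forall d v, G d v -> [/\ D d, lo <= d & d <= hi]) ->
  (forall d v v', G d v -> G d v' -> v = v') ->
  exists t, 0 < t /\ forall d v, G d v -> g < v -> g + t <= v.
Proof.
move=> defD sD defG GD Gfun; apply: contrapT => acc.
have {}acc t : 0 < t -> exists d v, [/\ G d v, g < v & v < g + t].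
  move=> t_gt0; apply: contrapT => H; apply: acc; exists t;
    split=> // d v Gdv gv.
  by rewrite leNgt; apply/negP => vt; apply: H; exists d, v.
pose Y : set R := [set d | exists v, G d v /\ g < v].
have defY : definable1 Y by rewrite /Y /=; prove_definable.
have [d0 [[v0 [G0 gv0]] d0min]] : exists m, Y m /\ lbound Y m.
  apply: (has_minimum (D := D) (lb := lo)) => //.
  - by move=> d [v [/GD[]]].
  - by have [d [v [? ? _]]] := acc _ t0_gt0; exists d, v.
  - by move=> d [v [/GD[]]].
(* [Z] holds the records: points whose value above [g] is smaller than all earlier values above
   [g]. *)
pose Z : set R := [set d | exists v, G d v /\ g < v /\
  forall d' v', G d' v' -> g < v' -> d' < d -> v < v'].
have defZ : definable1 Z by rewrite /Z /=; prove_definable.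
have [d1 [[v1 [G1 [gv1 d1P]]] d1max]] : exists m, Z m /\ ubound Z m.
  apply: (has_maximum (D := D) (ub := hi)) => //.
  - by move=> d [v [/GD[]]].
  - exists d0, v0; do 2!split=> //; move=> d' v' G' gv'.
    by rewrite ltNge d0min//; exists v'.
  - by move=> d [v [/GD[]]].
(* By accumulation some values lie between [g] and [v1]. The first point [d2] with such a value is a
   record, so [d2 <= d1]; but the record at [d1] only allows larger values before it. *)
pose W : set R := [set d | exists v, G d v /\ g < v /\ v < v1].
have defW : definable1 W by rewrite /W /=; prove_definable.
have [d2 [[v2 [G2 [gv2 v21]]] d2min]] : exists m, W m /\ lbound W m.
  apply: (has_minimum (D := D) (lb := lo)) => //.
  - by move=> d [v [/GD[]]].
  - have [|d [v [Gdv gv]]] := acc (v1 - g); first by rewrite osub_gt0.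
    by rewrite addrC subrK; exists d, v.
  - by move=> d [v [/GD[]]].
have : d2 <= d1.
  apply: d1max; exists v2; do 2!split=> //; move=> d' v' G' gv' lt.
  apply: lt_le_trans v21 _; rewrite leNgt; apply/negP => lt'.
  by move: lt; rewrite ltNge d2min//; exists v'.
rewrite le_eqVlt => /predU1P [E|/(d1P _ _ G2 gv2)].
  by rewrite E in G2; rewrite (Gfun _ _ _ G1 G2) ltxx in v21.
by rewrite ltNge ltW.
Qed.

End DefinableDiscrete.

(** * Finiteness of the set of gaps *)

(** An infinite set may contain no infinite increasing sequence, so [n] distinct elements are
    sorted. *)
Lemma increasing_seq (R : oagType) (P : set R) n : infinite_set P ->
  exists g : nat -> R, (forall i j, (i < j)%N -> (j < n)%N -> g i < g j) /\
    forall i, (i < n)%N -> P (g i).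
Proof.
move=> /infinite_seq [f [injf fP]]; pose s := sort <=%O (mkseq f n).
have ss : size s = n by rewrite size_sort size_mkseq.
have lts : sorted <%O s.
  rewrite lt_sorted_uniq_le sort_le_sorted andbT sort_uniq.
  by rewrite map_inj_uniq ?iota_uniq.
exists (nth 0 s); split=> [i j ij jn|i lin].
  apply: (sorted_ltn_nth lt_trans) => //; rewrite inE ss//.
  exact: ltn_trans jn.
have : nth 0 s i \in s by rewrite mem_nth ?ss.
by rewrite mem_sort => /mapP [k _ ->].
Qed.

Lemma finite_bounds (R : oagType) (u : nat -> R) n :
  exists lo hi : R, forall i, (i < n)%N -> lo <= u i <= hi.
Proof.
elim: n => [|n [lo [hi IH]]]; first by exists 0, 0.
exists (Order.min lo (u n)), (Order.max hi (u n)) => i.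
rewrite ltnS leq_eqVlt ge_min le_max => /predU1P [->|/IH /andP[-> ->]//].
by rewrite !lexx !orbT.
Qed.

Section Gaps.
Variables (L : language) (R : oagType) (I0 : interpretation L R).
Let I := expansion I0.
Hypotheses (divR : divisible R) (burden2 : has_burden I 'I_2).
Hypothesis dcR : definably_complete I.
Variable t0 : R.
Hypothesis t0_gt0 : 0 < t0.
Implicit Types D X : set R.

Local Notation definable1 X := (definable_pred I0 (fun e => X (e 0%N))).

Definition next_in D (d d' : R) : Prop :=
  D d /\ D d' /\ d < d' /\ forall y, D y -> d < y -> d' <= y.

Lemma next_in_exists D d y : definable1 D -> separated D -> D d -> D y ->
  d < y ->
  exists d', next_in D d d'.
Proof.
move=> defD sD Dd Dy dy.
have [|x []|||d' [[Dd' dd'] d'min]] :=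
    has_minimum divR burden2 dcR t0_gt0 (lb := d) defD sD
      (X := [set x | D x /\ d < x]).
- by rewrite /=; prove_definable.
- by [].
- by exists y.
- by move=> x [_ /ltW].
- by exists d'; split=> //; split=> //; split=> // x Dx dx; apply: d'min.
Qed.

Lemma next_in_uniq D d d1 d2 : next_in D d d1 -> next_in D d d2 -> d1 = d2.
Proof.
move=> [_ [D1 [lt1 m1]]] [_ [D2 [lt2 m2]]].
by apply: le_anti; rewrite m1 ?m2.
Qed.

Definition gaps D : set R := [set g | exists d, next_in D d (d + g)].

(* With [2n] gaps [g_1 < ... < g_2n], the first [n] of them fit inside gaps of
   the [n] larger lengths. *)
Lemma finite_gaps D : definable1 D -> separated D -> finite_set (gaps D).
Proof.
move=> defD sD; apply: contrapT => inf.
apply: (no_grid divR burden2 (A := fun _ _ _ x => D x)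
  (B := fun lo hi _ y => exists d, lo <= d /\ d <= hi /\ next_in D d (d + y))).
- by rewrite /definable4; prove_definable.
- by rewrite /definable4 /next_in; prove_definable.
move=> n; have [g [gmono gP]] := increasing_seq (n + n).+1 inf.
have /choice [e eP] : forall i, exists d, (i < (n + n).+1)%N ->
  next_in D d (d + g i).
  move=> i; case: (ltnP i (n + n).+1) => [/gP [d dP]|_]; last by exists 0.
  by exists d.
have ginj i j : (i < (n + n).+1)%N -> (j < (n + n).+1)%N -> g i = g j -> i = j.
  move=> li lj E; have [lt|lt|//] := ltngtP i j.
    by have := gmono _ _ lt lj; rewrite E ltxx.
  by have := gmono _ _ lt li; rewrite E ltxx.
have ltn2 i : (i < n)%N -> (i < (n + n).+1)%N.
  by move=> li; rewrite ltnS ltnW// ltn_addr.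
have ltn3 i : (i < n)%N -> (n + i < (n + n).+1)%N.
  by move=> li; rewrite ltnS leq_add2l ltnW.
have lenn : (n < (n + n).+1)%N by rewrite ltnS leq_addr.
(* The bounds confine [B] to the gaps of a bounded part of [D], where [image_right_isolated]
   applies. *)
have [lo [hi lohi]] := finite_bounds e n.
(* The middle gap [g n] is the width: the points [e (n + i)] have gaps at least [g n], while
   [g i < g n] for [i < n]. *)
exists lo, hi, 0, (g n), (fun i => e (n + i)%N), g; split.
- move=> i j li lj E; apply/(@addnI n)/ginj; [exact: ltn3|exact: ltn3|].
  have := eP _ (ltn3 _ lj); rewrite -E => /(next_in_uniq (eP _ (ltn3 _ li))).
  exact: addrI.
- by move=> i j li lj; apply: ginj; apply: ltn2.
- move=> i li; have [De [_ [_ emin]]] := eP _ (ltn3 _ li); split=> // y Dy lt.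
  apply: le_trans (emin _ Dy lt); rewrite oleD2l.
  case: i li {De emin lt} => [|i] li; first by rewrite addn0.
  by rewrite ltW// gmono// ?ltn3// -addSnnS leq_addr.
- move=> i li; have /andP[lo_e e_hi] := lohi _ li;
  have next := eP _ (ltn2 _ li).
  split; first by exists (e i).
    rewrite gmono// andbT; have [_ [_ [+ _]]] := next.
    by rewrite oltDl => /ltW.
  pose G d v := lo <= d /\ d <= hi /\ next_in D d (d + v).
  have [|d v [? [? []]]|d v v' [_ [_ N]] [_ [_ N']]|t [t_gt0 tP]] :=
    image_right_isolated divR burden2 dcR t0_gt0 (g i) defD sD
      (G := G) (lo := lo) (hi := hi).
  + by rewrite /definable2 /G /next_in; prove_definable.
  + by [].
  + exact: addrI (next_in_uniq N N').
  + by exists t; split=> // v [d dP]; apply: tP; exact: dP.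
Qed.

End Gaps.

(** * Words of gaps *)

(** Pigeonhole, once for each of the first [k] functions. *)
Lemma infinite_fibers (T V : Type) (f : nat -> T -> V) (k : nat) (X : set T) :
  (forall i, finite_set (range (f i))) -> infinite_set X ->
  exists Y : set T, [/\ Y `<=` X, infinite_set Y &
    forall i x y, (i < k)%N -> Y x -> Y y -> f i x = f i y].
Proof.
move=> fin infX; elim: k => [|k [Y [YX infY Yf]]]; first by exists X; split.
have [v infv] : exists v, infinite_set (Y `&` f k @^-1` [set v]).
  apply: contrapT => H; apply: infY.
  apply: (sub_finite_set (B := \bigcup_(v in range (f k)) (Y `&` f k @^-1` [set
    v]))).
    by move=> x Yx; exists (f k x); [exists x|split].
  by apply: bigcup_finite => // v _; apply: contrapT => nf; apply: H; exists v.
exists (Y `&` f k @^-1` [set v]); split=> //; first by move=> x [/YX].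
move=> i x y; rewrite ltnS leq_eqVlt => /predU1P [->|lt] [Yx /= fx] [Yy /= fy].
  by rewrite fx fy.
exact: Yf.
Qed.

(* A successor function on [D], extended beyond [D] by steps of a length [u]
   which marks the absence of a successor in [D]. *)
Record successor_on (R : oagType) (D : set R) (S : R -> R) (u : R) : Prop := {
  succ_gt : forall x, x < S x;
  succ_le : forall d y, D d -> D y -> d < y -> S d <= y;
  succ_in : forall d, D d -> S d - d <> u -> D (S d);
  succ_max : forall d y, D d -> D y -> S d - d = u -> y <= d;
  succ_fin : finite_set (range (fun x => S x - x)) }.

Section Successor.
Variables (R : oagType) (D : set R) (S : R -> R) (u : R).
Hypothesis sucS : successor_on D S u.

Definition gap (x : R) : R := S x - x.

Lemma gapE x : x + gap x = S x.
Proof. by rewrite addrC subrK. Qed.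

Lemma iter_succ_le i j x : (i <= j)%N -> iter i S x <= iter j S x.
Proof.
elim: j => [|j IH]; first by rewrite leqn0 => /eqP ->.
rewrite leq_eqVlt => /predU1P [->//|/IH /le_trans]; apply.
exact/ltW/(succ_gt sucS).
Qed.

Lemma iter_succ_lt i j x : (i < j)%N -> iter i S x < iter j S x.
Proof.
by move=> ij; apply: lt_le_trans (iter_succ_le x ij); exact: (succ_gt sucS).
Qed.

Lemma iter_succ_inj x : injective (fun i => iter i S x).
Proof.
move=> i j E;
  have [/(@iter_succ_lt _ _ x)|/(@iter_succ_lt _ _ x)|//] := ltngtP i j;
  by rewrite E ltxx.
Qed.

(** The displacement after [i] steps is the sum of the first [i] gaps. *)
Lemma iter_succ_shift d d' k :
  (forall i, (i < k)%N -> gap (iter i S d) = gap (iter i S d')) ->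
  forall i, (i <= k)%N -> iter i S d - d = iter i S d' - d'.
Proof.
move=> H; elim=> [|i IH] lik; first by rewrite !subrr.
rewrite !iterS -!gapE [_ + gap _ - d]addrAC [_ + gap _ - d']addrAC IH 1?ltnW//.
by rewrite H.
Qed.

Lemma iter_succ_in d k : D d -> (forall i, (i < k)%N ->
  gap (iter i S d) <> u) ->
  forall i, (i <= k)%N -> D (iter i S d).
Proof.
move=> Dd H; elim=> [//|i IH] lik; apply: (succ_in sucS); first exact/IH/ltnW.
exact: H.
Qed.

Lemma between_iter_succ d k y : D d ->
  (forall i, (i < k)%N -> gap (iter i S d) <> u) ->
  D y -> d <= y -> y < iter k S d -> exists2 j, (j < k)%N & y = iter j S d.
Proof.
move=> Dd H Dy dy; elim: k H => [|k IH] H; first by rewrite /= ltNge dy.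
have [lt _|] := ltP y (iter k S d).
  have [|j lj ->] := IH _ lt; first by move=> i /ltnW; apply: H.
  by exists j => //; apply: ltnW.
rewrite le_eqVlt => /predU1P [<- _|lt]; first by exists k.
have Dk : D (iter k S d).
  by apply: (@iter_succ_in d k Dd) => // i /ltnW; apply: H.
by rewrite ltNge iterS (succ_le sucS).
Qed.

(** First-order substitute for equality of words: one formula for all word lengths, as a grid
    requires, without mention of [S]. *)
Definition agree (r x b : R) : Prop :=
  forall y, 0 <= y -> y <= r -> (D (x + y) <-> D (b + y)).

Lemma agree_of_word d b k : D d -> D b ->
  (forall i, (i < k)%N -> gap (iter i S b) <> u) ->
  (forall i, (i < k)%N -> gap (iter i S d) = gap (iter i S b)) ->
  agree (iter k S b - b) d b.
Proof.
suff H x z : D x -> D z -> (forall i, (i < k)%N -> gap (iter i S z) <> u) ->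
    (forall i, (i < k)%N -> gap (iter i S x) = gap (iter i S z)) ->
    forall y, 0 <= y -> y <= iter k S z - z -> D (x + y) -> D (z + y).
  move=> Dd Db nub db y y0 yr; split; first exact: H.
  apply: H => // [i lik|i lik|]; rewrite ?db//; first exact: nub.
  by rewrite (iter_succ_shift db).
move=> Dx Dz nuz xz y y0; rewrite -(iter_succ_shift xz)// => yr Dxy.
have [j ljk E] : exists2 j, (j <= k)%N & x + y = iter j S x.
  have [E|ne] := eqVneq (x + y) (iter k S x); first by exists k.
  have [|||j ljk] := @between_iter_succ x k _ Dx _ Dxy.
  - by move=> i lik; rewrite xz//; exact: nuz.
  - by rewrite oleDl.
  - rewrite lt_neqAle ne /=; move: yr; rewrite -(oleD2l x).
    by rewrite [x + (_ - x)]addrC subrK.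
  - by exists j => //; apply: ltnW.
have -> : y = iter j S z - z by rewrite -(iter_succ_shift xz)// -E addrC addKr.
by rewrite addrC subrK; apply: (iter_succ_in Dz nuz).
Qed.

(** By induction the displacements from [d] and [b] coincide: each successor, transported to the
    other side, bounds the successor there. *)
Lemma word_of_agree d b k : D d -> D b ->
  (forall i, (i < k)%N -> gap (iter i S b) <> u) ->
  agree (iter k S b - b) d b ->
  forall i, (i < k)%N -> gap (iter i S d) = gap (iter i S b).
Proof.
move=> Dd Db nub ag.
have sumb i : b + (iter i S b - b) = iter i S b by rewrite addrC subrK.
have sumd i : d + (iter i S d - d) = iter i S d by rewrite addrC subrK.
have shift i : (i <= k)%N -> iter i S d - d = iter i S b - b.
  elim: i => [|i IH] lik; first by rewrite /= !subrr.
  have {}IH := IH (ltnW lik).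
  have Di : D (iter i S d).
    rewrite -sumd IH; apply/ag; last by rewrite sumb;
      apply: (iter_succ_in Db nub); exact: ltnW.
      by rewrite osub_ge0; exact: (@iter_succ_le 0).
    by rewrite oleD2r iter_succ_le// ltnW.
  have le_r : iter i.+1 S b - b <= iter k S b - b by rewrite oleD2r
    iter_succ_le.
  have DSi : D (d + (iter i.+1 S b - b)).
    apply/ag => //; last by rewrite sumb; apply: (iter_succ_in Db nub).
    by rewrite osub_ge0; exact: (@iter_succ_le 0).
  have lt1 : iter i S d < d + (iter i.+1 S b - b).
    by rewrite -sumd IH oltD2l oltD2r; exact: (@iter_succ_lt i i.+1).
  have le1 := succ_le sucS Di DSi lt1; rewrite -iterS -oleBlD in le1.
  apply/eqP; rewrite eq_le le1 /= oleBlD.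
  have /(succ_le sucS) : D (iter i S b).
    by apply: (iter_succ_in Db nub); exact: ltnW.
  apply; last by rewrite -(sumb i) -IH oltD2l oltD2r;
    exact: (@iter_succ_lt i i.+1).
  rewrite -iterS; apply/ag; [|exact: le_trans le_r|rewrite sumd].
    by rewrite osub_ge0; exact: (@iter_succ_le 0 i.+1).
  (* The marker [u] would make [iter i S d] the maximum of [D], but a point of [D] lies beyond
     it. *)
  rewrite iterS; have [E|] := eqVneq (gap (iter i S d)) u;
    last by move/eqP/(succ_in sucS); exact.
  by have := succ_max sucS Di DSi E; rewrite leNgt lt1.
have gapB x i : gap (iter i S x) = (iter i.+1 S x - x) - (iter i S x - x).
  by rewrite opprB addrA subrK.
by move=> i lik; rewrite !gapB !shift// ltnW.
Qed.

End Successor.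

(** * Almost periodicity *)

Section AlmostPeriodic.
Variables (L : language) (R : oagType) (I0 : interpretation L R).
Let I := expansion I0.
Hypotheses (divR : divisible R) (burden2 : has_burden I 'I_2).
Hypothesis dcR : definably_complete I.
Variable t0 : R.
Hypothesis t0_gt0 : 0 < t0.
Variable D : set R.
Hypotheses (defD : definable_pred I0 (fun e => D (e 0%N))) (sD : separated D).

Lemma successor_exists : exists S u, successor_on D S u.
Proof.
have fing := finite_gaps divR burden2 dcR t0_gt0 defD sD.
(* There are infinitely many positive elements but finitely many gaps. *)
have [u [u0 nu]] : exists u : R, 0 < u /\ ~ gaps D u.
  have [f [injf fP]] := small_seq divR t0_gt0.
  apply: contrapT => H.
  have fD k : gaps D (f k).
    by apply: contrapT => nf; apply: H; exists (f k); have /andP[] := fP k.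
  apply: infinite_nat.
  rewrite (_ : setT = f @^-1` gaps D); last first.
    by apply/seteqP; split=> // k _; exact: fD.
  by apply: finite_preimage => // x y _ _; exact: injf.
pose S x := if pselect (exists d', next_in D x d') is left e
            then projT1 (cid e) else x + u.
have SP x : next_in D x (S x) \/ (~ (exists d', next_in D x d') /\ S x = x + u).
  rewrite /S; case: pselect => [e|ne]; last by right.
  by left; case: cid.
have gap_u x : S x - x = u -> ~ exists d', next_in D x d'.
  move=> E; have [N|[]//] := SP x.
  by case: nu; exists x; rewrite -E addrC subrK.
exists S, u; split.
- by move=> x; have [[_ [_ []]]|[_ ->]] := SP x; rewrite ?oltDl.
- move=> d y Dd Dy dy; have [[_ [_ [_]]]|[]] := SP d; first exact.
  by case; apply: (next_in_exists divR burden2 dcR t0_gt0 defD sD Dd Dy dy).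
- move=> d Dd; have [[_ [DS _]]//|[_ ->]] := SP d.
  by rewrite addrC addKr.
- move=> d y Dd Dy /gap_u ne; rewrite leNgt; apply/negP => dy; apply: ne.
  exact: (next_in_exists divR burden2 dcR t0_gt0 defD sD Dd Dy dy).
- apply: (@sub_finite_set _ _ (gaps D `|` [set u]));
  last by rewrite finite_setU.
  move=> _ [x _ <-]; have [N|[_ ->]] := SP x; last by right;
    rewrite addrC addKr.
  by left; exists x; rewrite addrC subrK.
Qed.

Variables (S : R -> R) (u : R).
Hypothesis sucS : successor_on D S u.
Local Notation gap := (gap S).

(* Otherwise, for each [n] some word occurs at points [a_1, ..., a_n] of [D]
   with no other occurrence in the next [n] steps, and with the same next [n]
   gaps; the occurrences of this word form the set [A] of a grid. *)
Lemma almost_recurrent : exists n : nat, forall k,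
  finite_set [set d | D d /\ forall j, (0 < j)%N -> (j <= n)%N ->
    exists2 i, (i < k)%N & gap (iter (i + j) S d) <> gap (iter i S d)].
Proof.
apply: contrapT => H.
apply: (no_grid divR burden2
  (A := fun b r _ x => D x /\ agree D r x b) (B := fun b _ _ y => D (b + y))).
- by rewrite /definable4 /agree; prove_definable.
- by rewrite /definable4; prove_definable.
move=> n.
have [k infk] : exists k, infinite_set [set d | D d /\ forall j, (0 < j)%N ->
    (j <= n)%N ->
    exists2 i, (i < k)%N & gap (iter (i + j) S d) <> gap (iter i S d)].
  by apply: contrapT => H'; apply: H; exists n => k; apply: contrapT => nf;
    apply: H'; exists k.
have [|Y [YX infY Yw]] := infinite_fibers (f := fun i x =>
  gap (iter i S x)) (k + n) _ infk.
  by move=> i; apply: sub_finite_set (succ_fin sucS) => _ [x _ <-];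
    exists (iter i S x).
have [a [inja aY]] := infinite_seq infY.
have aD i : D (a i) by have [] := YX _ (aY i).
have aw i j l : (l < k + n)%N -> gap (iter l S (a i)) = gap (iter l S (a j)).
  by move=> ll; apply: Yw.
(* If [u] occurred at the same place after two points, both would reach the maximum of [D] by the
   same displacement, hence coincide. *)
have nu i l : (l < k + n)%N -> gap (iter l S (a i)) <> u.
  elim/ltn_ind: l i => l IH i ll E.
  have D_l j : D (iter l S (a j)).
    apply: (iter_succ_in sucS (k := l)) => // m lm.
    by apply: IH => //; apply: ltn_trans ll.
  have E' : gap (iter l S (a i.+1)) = u by rewrite (aw _ i).
  have E2 : iter l S (a i) = iter l S (a i.+1).
    by apply: le_anti;
      rewrite (succ_max sucS (D_l i) _ E)// (succ_max sucS (D_l i.+1) _ E').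
  have : iter l S (a i) - a i = iter l S (a i.+1) - a i.+1.
    apply: (@iter_succ_shift _ S _ _ l) => // m lm.
    by apply: aw; apply: ltn_trans ll.
  by rewrite E2 => /addrI /oppr_inj /inja /n_Sn.
have ltk l : (l < k)%N -> (l < k + n)%N by move=> lk; rewrite ltn_addr.
have ltn l : (l < n)%N -> (l < k + n)%N by move=> ln; rewrite ltn_addl.
pose b := a 0%N.
(* [A] is given by [b] and the span of its word of length [k], [B] is [D - b], and the width is the
   span of [n] steps. *)
exists b, (iter k S b - b), 0, (iter n S b - b), a, (fun i => iter i S b - b);
  split.
- by move=> i j _ _; exact: inja.
- by move=> i j _ _ /addIr; exact: (iter_succ_inj sucS).
- move=> i lin; split.
    split=> //; apply: (agree_of_word sucS) => //; first exact: aD;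
      move=> l lk; last by apply: aw; exact: ltk.
    by apply: nu; exact: ltk.
  move=> y [Dy ag] lt.
  have -> : a i + (iter n S b - b) = iter n S (a i).
    rewrite (@iter_succ_shift _ S b (a i) n) ?[a i + _]addrC ?subrK//.
    by move=> l ln; apply: aw; exact: ltn.
  (* A nearer occurrence [y] is a [j]-th successor of [a i] with [0 < j < n], a recurrence excluded
     in [Y]. *)
  rewrite leNgt; apply/negP => yn.
  have [j jn yj] := between_iter_succ sucS (aD i) (fun l ln =>
    nu i l (ltn l ln)) Dy (ltW lt) yn.
  have j0 : (0 < j)%N by case: j {jn} yj lt => // ->; rewrite ltxx.
  have [_ /(_ j j0 (ltnW jn)) [l lk]] := YX _ (aY i).
  apply; rewrite iterD -yj (aw i 0%N) ?ltk//.
  by apply: (word_of_agree sucS Dy (aD 0%N) _ ag lk) => m mk; apply: nu;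
    exact: ltk.
- move=> j jn; split.
  + rewrite addrC subrK; apply: (iter_succ_in sucS (aD 0%N) (k := n));
    last exact: ltnW.
    by move=> l ln; apply: nu; exact: ltn.
  + rewrite osub_ge0 oltD2r (iter_succ_lt sucS)// andbT.
    exact: (@iter_succ_le _ _ _ _ sucS 0).
  + have [|t [t_gt0 tP]] := @separated_above _ D (iter j S b) sD.
      apply: (iter_succ_in sucS (aD 0%N) (k := n)); last exact: ltnW.
      by move=> l ln; apply: nu; exact: ltn.
    exists t; split=> // y Dy; rewrite oltBlD => /(tP _ Dy).
    by rewrite addrAC oleBlD.
Qed.

(* If [1 <= j <= n] is a period of the word of length [n!] at [d], so is
   [n!]. *)
Lemma almost_periodic : exists N : nat, (0 < N)%N /\
  finite_set [set d | D d /\ gap (iter N S d) <> gap d].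
Proof.
have [n fin] := almost_recurrent; exists n`!; split; first exact: fact_gt0.
apply: sub_finite_set (fin n`!) => d [Dd nper]; split=> // j j0 jn.
apply: contrapT => H; apply: nper.
have per i : (i < n`!)%N -> gap (iter (i + j) S d) = gap (iter i S d).
  by move=> lt; apply: contrapT => ne; apply: H; exists i.
have perM m : (m * j <= n`!)%N -> gap (iter (m * j) S d) = gap d.
  elim: m => [//|m IH]; rewrite mulSnr => le.
  rewrite per; first exact/IH/(leq_trans (leq_addr j _) le).
  by apply: leq_trans le; rewrite -[X in (X < _)%N]addn0 ltn_add2l.
have /dvdnP [q E] : (j %| n`!)%N by apply: dvdn_fact; rewrite j0.
by rewrite E perM// -E.
Qed.

End AlmostPeriodic.

(** * Decomposition *)

(** Points with meeting orbits share a representative. If [p] steps from [x] and [q] steps from the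
    representative lead to the same point, [c x] is [q - p] modulo [N]; injectivity makes this
    consistent. *)
Lemma chain_class (T : choiceType) (x0 : T) (S : T -> T) N : (0 < N)%N ->
  (forall x, injective (fun i => iter i S x)) ->
  exists c : T -> nat, forall x, c (S x) = (c x).+1 %[mod N].
Proof.
move=> N0 injS; pose meets x y := exists p q, iter p S x = iter q S y.
pose rep x := xget x0 (meets x).
have repP x : meets x (rep x).
  by rewrite /rep; case: xgetP => // /(_ x); case; exists 0%N, 0%N.
have repS x : rep (S x) = rep x.
  rewrite /rep; congr xget; apply/funext => y; apply/propext;
    split=> -[p [q E]].
    by exists p.+1, q; rewrite iterSr.
  by exists p, q.+1; rewrite -iterSr /= E.
have /choice [c cP] : forall x, exists c, exists p q,
    iter p S x = iter q S (rep x) /\ q = c + p %[mod N].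
  (* The term [N.-1 * p] stands for [- p] modulo [N]. *)
  move=> x; have [p [q E]] := repP x; exists (q + N.-1 * p)%N, p, q; split=> //.
  by rewrite -addnA -mulSnr prednK// addnC mulnC modnMDl.
exists c => x; have [p [q [E Eq]]] := cP x; have [p' [q' [E' Eq']]] := cP (S x).
rewrite repS in E'.
have H : (p + q' = p'.+1 + q)%N.
  by apply: (injS (rep x)); rewrite !iterD -E' -E -iterSr -!iterD addnC.
apply/eqP; rewrite -(eqn_modDr (p' + p)); apply/eqP.
rewrite addnA -modnDml -Eq' modnDml addnC H -modnDmr Eq modnDmr.
by rewrite addnCA !addSn addnS.
Qed.

Section Decomposition.
Variables (R : oagType) (D : set R) (S : R -> R) (u : R) (N : nat).
Hypotheses (dD : discrete D) (sucS : successor_on D S u) (N0 : (0 < N)%N).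
Local Notation gap := (gap S).
Hypothesis finB : finite_set [set d | D d /\ gap (iter N S d) <> gap d].

Lemma finite_range_iter n : finite_set (range (fun x => iter n S x - x)).
Proof.
elim: n => [|n IH].
  by apply: (@sub_finite_set _ _ [set 0]) => // _ [x _ <-]; rewrite /= subrr.
apply: (@sub_finite_set _ _
  (range (fun x => (iter n S (S x) - S x) + (S x - x)))).
  by move=> _ [x _ <-]; exists x => //; rewrite addrA subrK iterSr.
apply: (@finite_image11 _ _ _ _ _ (fun a b => a + b));
  last exact: (succ_fin sucS).
by apply: sub_finite_set IH => _ [x _ <-]; exists (S x).
Qed.

(** The cut points: failures of periodicity, and the maximum of [D] if any, recognized by the marker
    [u]. *)
Definition breaks : set R :=
  [set d | D d /\ gap (iter N S d) <> gap d] `|` [set d | D d /\ gap d = u].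

Lemma finite_breaks : finite_set breaks.
Proof.
rewrite finite_setU; split=> //.
have [[m [Dm mu]]|ne] := pselect (exists m, D m /\ gap m = u).
  apply: (@sub_finite_set _ _ [set m]) => // d [Dd du].
  by apply: le_anti; rewrite (succ_max sucS Dd Dm du) (succ_max sucS Dm Dd mu).
by apply: (@sub_finite_set _ _ set0) => // d dP; apply: ne; exists d.
Qed.

(** With [s] listing the breaks, a label records the class modulo [N], the position relative to the
    breaks, and the displacement over [N] steps, which becomes the constant difference. *)
Definition piece (c : R -> nat) (s : seq R) (l
  : nat * (size s).-tuple bool * R) :
    set R :=
  [set d | [/\ D d, ~ breaks d & l =
    ((c d %% N)%N, map_tuple (fun b => b < d) (in_tuple s), iter N S d - d)]].

Lemma piece_next c (s : seq R) l e e'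
  : (forall x, c (S x) = (c x).+1 %[mod N]) ->
  breaks = [set` s] -> @piece c s l e -> @piece c s l e' -> e < e' ->
  piece c l (e + l.2) /\ e + l.2 <= e'.
Proof.
move=> cS Bs [De nBe El] [De' nBe' El'] ee'.
have -> : e + l.2 = iter N S e by rewrite El /= addrC subrK.
have below b : b \in s -> (b < e) = (b < e').
  move: El'; rewrite El => -[_ /eq_in_map + _]; exact.
have c_iter i : c (iter i S e) = c e + i %[mod N].
  elim: i => [|i IH]; first by rewrite addn0.
  by rewrite iterS cS -addn1 -modnDml IH modnDml addn1 addnS.
have inD i : iter i S e <= e' -> D (iter i S e).
  elim: i => [//|i IH] le; have lt : iter i S e < e'.
    by apply: lt_le_trans le; exact: (succ_gt sucS).
  apply: (succ_in sucS); first exact/IH/ltW.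
  by move=> /(succ_max sucS (IH (ltW lt)) De'); rewrite leNgt lt.
have belowi i b : iter i S e <= e' -> b \in s -> (b < iter i S e) = (b < e).
  move=> le bs; apply/idP/idP; last first.
    by move=> lt; apply: lt_le_trans lt _;
      exact: (@iter_succ_le _ _ _ _ sucS 0).
  by rewrite (below b bs) => lt; apply: lt_le_trans le.
(* A break between [e] and [e'] would distinguish their positions. *)
have nB i : iter i S e <= e' -> ~ breaks (iter i S e).
  move=> le; have [->//|ne] := eqVneq (iter i S e) e'.
  have lt : iter i S e < e' by rewrite lt_neqAle ne.
  by rewrite Bs /= => bs; have := belowi i _ le bs;
    rewrite ltxx (below _ bs) lt.
(* Reaching [e'] after [j < N] steps would force [j = 0], as [e] and [e'] have the same class modulo
   [N]. *)
have le_e' j : (j <= N)%N -> iter j S e <= e'.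
  elim: j => [_|j IH jN]; first exact: ltW.
  have le := IH (ltnW jN); move: (le); rewrite le_eqVlt => /predU1P [E|lt].
    move: El'; rewrite El => -[Ec _ _]; move: Ec; rewrite -E c_iter => /eqP.
    rewrite -[X in X == _ %[mod _]]addn0 eqn_modDl mod0n modn_small// eq_sym.
    by move=> /eqP j0; rewrite -E j0 ltxx in ee'.
  exact: (succ_le sucS (inD j le) De' lt).
have eN := le_e' _ (leqnn N); split=> //; split; [exact: inD|exact: nB|].
(* Moving the start by one step drops one gap and adds the gap [N] steps later, which is equal away
   from breaks. *)
have per i : (i <= N)%N -> iter N S (iter i S e) - iter i S e = iter N S e - e.
  elim: i => [//|i IH] iN; rewrite -{}IH ?(ltnW iN)//.
  have gapi : gap (iter N S (iter i S e)) = gap (iter i S e).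
    have le := le_e' _ (ltnW iN); apply: contrapT => ne.
    by apply: (nB i le); left; split=> //; apply: inD.
  rewrite [iter i.+1 S e]iterS -iterSr iterS -(gapE S (iter N S _)) gapi /gap.
  by rewrite addrA addrAC addrK.
rewrite El per//; congr (_, _, _).
  by rewrite c_iter modnDr.
apply/val_inj/eq_in_map => b bs /=.
by rewrite belowi.
Qed.

Lemma decomposition : exists (F : set R) (n : nat) (E : 'I_n -> set R),
    [/\ finite_set F,
        forall i : 'I_n, pseudo_arithmetic (E i)
      & D = F `|` \bigcup_(i in [set: 'I_n]) E i].
Proof.
have [s Bs] := (finite_seqP _).1 finite_breaks.
have [c cS] := @chain_class R 0 S N N0 (@iter_succ_inj _ _ _ _ sucS).
pose two l := exists e e', [/\ @piece c s l e, @piece c s l e' & e < e'].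
pose labels : set (nat * (size s).-tuple bool * R) :=
  `I_N `*` [set: (size s).-tuple bool] `*` range (fun x => iter N S x - x).
have fin_labels : finite_set labels.
  by apply: finite_setX (finite_range_iter N); apply: finite_setX.
have [js jsE] := (finite_seqP (labels `&` two)).1
  (sub_finite_set (@subIsetl _ _ _) fin_labels).
have pieceD l e : @piece c s l e -> D e by case.
(* A label with at most one point yields no difference, so its points join the finite set. *)
exists (breaks `|` \bigcup_(l in labels `\` two) @piece c s l), (size js),
  (fun i => @piece c s (tnth (in_tuple js) i)); split.
- rewrite finite_setU; split; first exact: finite_breaks.
  apply: bigcup_finite => [|l [_ n2]].
    by apply: sub_finite_set fin_labels => l [].
  have [[e Pe]|ne] := pselect (exists e, @piece c s l e); last first.
    by apply: (@sub_finite_set _ _ set0) => // e Pe; apply: ne; exists e.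
  apply: (@sub_finite_set _ _ [set e]) => // e' Pe' /=.
  by have [lt|lt|//] := ltgtP e' e; case: n2; [exists e', e|exists e, e'].
- move=> i; set l := tnth _ i.
  have [e [e' [Pe Pe' ee']]] : two l.
    by have [] : (labels `&` two) l by rewrite jsE /= mem_tnth.
  have sucP d : @piece c s l d -> above (@piece c s l) d !=set0 ->
      successors (@piece c s l) d (d + l.2).
    move=> Pd [y [Py dy]]; have [Pdl _] := piece_next cS Bs Pd Py dy.
    split; last by move=> z [Pz dz]; have [] := piece_next cS Bs Pd Pz dz.
    split=> //; case: Pd => _ _ ->; rewrite /= addrC subrK.
    exact: (@iter_succ_lt _ _ _ _ sucS 0 N).
  split; first by apply: discreteS dD => d; exact: pieceD.
    by move=> d Pd ab; exists (d + l.2); exact: sucP.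
  exists l.2; apply/seteqP; split=> [_ [a [b [Pa [ab bmin] ->]]]|_ ->].
    have [abl lmin] : successors (@piece c s l) a (a + l.2) by apply: sucP =>
      //; exists b.
    have -> : b = a + l.2 by apply: le_anti; rewrite bmin// lmin.
    by rewrite /= addrC addKr.
  exists e, (e + l.2); split=> //; last by rewrite addrC addKr.
  by apply: sucP => //; exists e'.
- apply/seteqP; split=> [d Dd|d [[|[l _ /pieceD//]]|[i _ /pieceD//]]];
  last first.
    by case=> -[].
  have [Bd|nBd] := pselect (breaks d); first by left; left.
  pose l := ((c d %% N)%N, map_tuple (fun b =>
    b < d) (in_tuple s), iter N S d - d).
  have Pd : @piece c s l d by [].
  have labl : labels l by split; [split=> //=; rewrite ltn_mod|exists d].
  have [l2|nl2] := pselect (two l); last by left; right; exists l.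
  have : [set` js] l by rewrite -jsE.
  by move=> /(@tnthP _ _ (in_tuple js) l) [i li]; right; exists i => //;
    rewrite -li.
Qed.

End Decomposition.

Theorem theorem3p2 (L : language) (R : oagType) (I : interpretation L R)
    (D : set R) :
  divisible R ->
  definably_complete (expansion I) ->
  has_burden (expansion I) 'I_2 ->
  definable (expansion I) D ->
  discrete D ->
  exists (F : set R) (n : nat) (E : 'I_n -> set R),
    [/\ finite_set F,
        forall i : 'I_n, pseudo_arithmetic (E i)
      & D = F `|` \bigcup_(i in [set: 'I_n]) E i].
Proof.
move=> divR dcR burden2 /definableE defD dD.
(* Without positive elements the group is trivial and [D] is finite. *)
have [[t0 t0_gt0]|R0] := pselect (exists t : R, 0 < t); last first.
  exists D, 0%N, (fun=> set0); split; last first.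
  - by rewrite (_ : \bigcup_(i in _) _ = set0) ?setU0// bigcup0.
  - by case.
  apply: (@sub_finite_set _ _ [set 0]) => // x _ /=.
  have [x0|x0|//] := ltgtP x 0; case: R0; last by exists x.
  by exists (- x); rewrite -[0]oppr0 oltN2.
have sD := discrete_separated t0_gt0 dD.
have [S [u sucS]] := successor_exists divR burden2 dcR t0_gt0 defD sD.
have [N [N0 finB]] := almost_periodic divR burden2 defD sD sucS.
exact: decomposition dD sucS N0 finB.
Qed.
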